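(* Let $n\ge 2$ and let $\Omega=[A_0,A_1,\dots,A_n]$ be a circumscriptible $n$-simplex in Euclidean $n$-space with balloon radii $x_0,x_1,\dots,x_n>0$, circumradius $R$ and edge-inradius $\rho$. Put $$M=\sum_{i=0}^{n}x_i,\qquad N=\sum_{i=0}^{n}x_i^2,\qquad P=\sum_{i=0}^{n}\frac{1}{x_i},\qquad Q=\sum_{i=0}^{n}\frac{1}{x_i^2}.$$ Then $$\left(\frac{R}{\rho}\right)^2=\frac{[MP-(n-1)(n-3)]^2-[M^2-(n-1)N][P^2-(n-1)Q]}{16(n-1)^2}$$ and $$R^2=\frac{[MP-(n-1)(n-3)]^2-[M^2-(n-1)N][P^2-(n-1)Q]}{8(n-1)[P^2-(n-1)Q]}.$$
   Context: An $n$-simplex $\Omega=[A_0,\dots,A_n]$ is the convex hull of $n+1$ affinely independent points $A_0,\dots,A_n$ (its vertices) in Euclidean $n$-space. Its edges are the $n(n+1)/2$ line segments joining two different vertices $A_i,A_j$; $a_{ij}$ denotes the length of the edge $A_iA_j$. The circumradius $R$ is the radius of the unique sphere passing through all $n+1$ vertices. The simplex is called circumscriptible (or edge-incentric) if there is a sphere tangent to all its $n(n+1)/2$ edges (the edges being line segments, so each point of tangency lies on the edge); this sphere is the edge-tangent sphere, and its radius $\rho$ is called the edge-inradius. The simplex is circumscriptible if and only if there exist real numbers $x_0,\dots,x_n>0$ with $a_{ij}=x_i+x_j$ for all $0\le i<j\le n$; these numbers $x_i$ are called the balloon radii of $\Omega$ (uniquely determined by the edge lengths when $n\ge 2$). 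*)

(* Defs.v *)
From mathcomp Require Import all_boot all_order all_algebra.
From mathcomp Require Import boolp classical_sets reals.

Set Implicit Arguments.
Unset Strict Implicit.
Unset Printing Implicit Defensive.

Import Order.TTheory GRing.Theory Num.Theory.
Local Open Scope classical_set_scope.
Local Open Scope ring_scope.

(* Euclidean n-space is 'rV[K]_n with the distance below; the norm that
   MathComp-Analysis puts on matrices is the sup norm, so it is not used. *)
Definition edist (K : realType) (n : nat) (u v : 'rV[K]_n) : K :=
  Num.sqrt (\sum_(k < n) (u 0 k - v 0 k) ^+ 2).

Definition sphere (K : realType) (n : nat) (c : 'rV[K]_n) (r : K)
    : set 'rV[K]_n :=
  [set X | edist X c = r].

Definition line (K : realType) (n : nat) (U V : 'rV[K]_n) : set 'rV[K]_n :=
  [set X | exists t : K, X = (1 - t) *: U + t *: V].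

Definition segment (K : realType) (n : nat) (U V : 'rV[K]_n)
    : set 'rV[K]_n :=
  [set X | exists2 t : K, 0 <= t <= 1 & X = (1 - t) *: U + t *: V].

Definition affinely_independent (K : realType) (n m : nat)
    (A : 'I_m -> 'rV[K]_n) : Prop :=
  forall l : 'I_m -> K,
    \sum_i l i = 0 -> \sum_i l i *: A i = 0 -> forall i, l i = 0.

(* An n-simplex of Euclidean n-space is given by its n + 1 vertices. *)
Definition is_simplex (K : realType) (n : nat) (A : 'I_n.+1 -> 'rV[K]_n)
    : Prop :=
  affinely_independent A.

Definition is_circumradius (K : realType) (n : nat)
    (A : 'I_n.+1 -> 'rV[K]_n) (R : K) : Prop :=
  exists O : 'rV[K]_n, forall i, sphere O R (A i).

(* A sphere of positive radius is tangent to a line when it meets the line in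
   exactly one point; for a segment, that point must lie on the segment. *)
Definition tangent_to_segment (K : realType) (n : nat)
    (c : 'rV[K]_n) (r : K) (U V : 'rV[K]_n) : Prop :=
  exists2 T : 'rV[K]_n, segment U V T & sphere c r `&` line U V = [set T].

Definition is_edge_tangent_sphere (K : realType) (n : nat)
    (A : 'I_n.+1 -> 'rV[K]_n) (c : 'rV[K]_n) (r : K) : Prop :=
  0 < r /\
  forall i j : 'I_n.+1, (i < j)%N -> tangent_to_segment c r (A i) (A j).

(* The edge-tangent sphere is unique when n >= 2. *)
Definition is_edge_inradius (K : realType) (n : nat)
    (A : 'I_n.+1 -> 'rV[K]_n) (rho : K) : Prop :=
  exists c : 'rV[K]_n, is_edge_tangent_sphere A c rho.

Definition circumscriptible (K : realType) (n : nat)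
    (A : 'I_n.+1 -> 'rV[K]_n) : Prop :=
  exists rho : K, is_edge_inradius A rho.

Definition is_balloon_radii (K : realType) (n : nat)
    (A : 'I_n.+1 -> 'rV[K]_n) (x : 'I_n.+1 -> K) : Prop :=
  (forall i, 0 < x i) /\
  forall i j : 'I_n.+1, (i < j)%N -> edist (A i) (A j) = x i + x j.

(* Main.v *)
Require Import Defs.
From mathcomp Require Import all_boot all_order all_algebra.
From mathcomp Require Import boolp classical_sets reals.
From mathcomp Require Import ring lra.

(** Let [c] and [rho] be the centre and radius of the edge-tangent sphere.  The
    tangent segments from [A_i] to this sphere all have the same length, and
    the two on an edge add up to that edge; as there are at least three
    vertices, these lengths are the balloon radii.  By Pythagoras
    [|A_i - c|^2 = rho^2 + x_i^2], and the edge lengths then give all the inner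
    products (lemma [gram_center]):
      [<A_i - c, A_j - c> = rho^2 - x_i x_j + 2 [i = j] x_i^2].
    This matrix is diagonal up to a perturbation of rank two, so barycentric
    coordinates can be solved for explicitly.  If [X] has barycentric
    coordinates [l] and [s = \sum_i l_i x_i], then (lemma [dot_center_bary])
      [<A_i - c, X - c> = rho^2 - s x_i + 2 x_i^2 l_i].
    - For [X = c] the left side vanishes.  Solving for [l_i] and summing [l_i]
      and [l_i x_i] gives two equations between [s] and [rho^2], from which
      [rho^2 (P^2 - (n-1) Q) = 2 (n-1)] (lemma [edge_inradius_sqr]).
    - For [X] the circumcentre the left side is
      [(rho^2 + x_i^2 + |X - c|^2 - R^2) / 2].  Summing [l_i], [l_i x_i] and
      [l_i x_i^2] determines [s], [|X - c|^2] and hence [R^2] (lemma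
      [circumradius_sqr]).
    The formula for [R / rho] is the quotient of these two. *)

Import Order.TTheory GRing.Theory Num.Theory.
Local Open Scope ring_scope.

(** * Inner products *)

Definition dot {K : realType} {n : nat} (u v : 'rV[K]_n) : K :=
  \sum_(k < n) u 0 k * v 0 k.

Section Dot.
Context {K : realType} {n : nat}.
Implicit Types (u v w : 'rV[K]_n) (a : K).

Lemma dotC u v : dot u v = dot v u.
Proof. by apply: eq_bigr => k _; rewrite mulrC. Qed.

Lemma dotDl u v w : dot (u + v) w = dot u w + dot v w.
Proof. by rewrite -big_split; apply: eq_bigr => k _; rewrite !mxE mulrDl. Qed.

Lemma dotZl a u v : dot (a *: u) v = a * dot u v.
Proof. by rewrite mulr_sumr; apply: eq_bigr => k _; rewrite !mxE mulrA. Qed.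

Lemma dotDr u v w : dot w (u + v) = dot w u + dot w v.
Proof. by rewrite dotC dotDl !(dotC _ w). Qed.

Lemma dotZr a u v : dot u (a *: v) = a * dot u v.
Proof. by rewrite dotC dotZl dotC. Qed.

Lemma dotNl u v : dot (- u) v = - dot u v.
Proof. by rewrite -scaleN1r dotZl mulN1r. Qed.

Lemma dotNr u v : dot u (- v) = - dot u v.
Proof. by rewrite dotC dotNl dotC. Qed.

Lemma dot0r u : dot u 0 = 0.
Proof. by rewrite -(scale0r 0) dotZr mul0r. Qed.

Lemma dot_sumr u (I : finType) (F : I -> 'rV[K]_n) :
  dot u (\sum_i F i) = \sum_i dot u (F i).
Proof.
by apply: (big_morph (dot u) (fun v w => dotDr v w u) (dot0r u)).
Qed.

Lemma dotvv_ge0 u : 0 <= dot u u.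
Proof. by apply: sumr_ge0 => k _; rewrite -expr2 sqr_ge0. Qed.

Lemma dotvv_eq0 u : dot u u = 0 -> u = 0.
Proof.
move=> /eqP; rewrite psumr_eq0 => [/allP u0|k _]; last by rewrite -expr2 sqr_ge0.
apply/rowP => k; rewrite mxE; apply/eqP.
by rewrite -(orbb (u 0 k == 0)) -mulf_eq0; apply: u0; rewrite mem_index_enum.
Qed.

Lemma edist_dot u v : edist u v = Num.sqrt (dot (u - v) (u - v)).
Proof.
by congr Num.sqrt; apply: eq_bigr => k _; rewrite !mxE expr2.
Qed.

Lemma edist_sqr u v : edist u v ^+ 2 = dot (u - v) (u - v).
Proof. by rewrite edist_dot sqr_sqrtr ?dotvv_ge0. Qed.

Lemma edistC u v : edist u v = edist v u.
Proof. by rewrite !edist_dot -opprB dotNl dotNr opprK. Qed.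

End Dot.

(** * Tangent lengths *)

(** The mirror image of [T] in the hyperplane through [c] orthogonal to the
    line lies on the line and on the sphere, so uniqueness of the intersection
    forces it to be [T] itself. *)
Lemma tangent_orthogonal {K : realType} {n : nat} (c : 'rV[K]_n) (r : K)
    (U V T : 'rV[K]_n) :
  (sphere c r `&` line U V = [set T])%classic -> dot (T - c) (V - U) = 0.
Proof.
move=> tgT; have [Tr [t Tt]] : (sphere c r `&` line U V)%classic T by rewrite tgT.
set d := V - U; set b := dot (T - c) d.
have [d0|dN0] := eqVneq (dot d d) 0.
  by rewrite /b (dotvv_eq0 _ d0) dot0r.
(* [T - e *: d] is the mirror image of [T]. *)
set e := 2 * b / dot d d.
have /(_ _)/esym TE : (sphere c r `&` line U V)%classic (T - e *: d) -> T - e *: d = T.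
  by rewrite tgT.
have : T = T - e *: d.
  apply: TE; split.
    rewrite /sphere /= -Tr !edist_dot addrAC; congr Num.sqrt.
    rewrite -/d; move: (T - c) @b @e => p b e.
    rewrite dotDl !dotDr !dotNl !dotNr !dotZl !dotZr (dotC d) -/b /e.
    by field.
  exists (t - e); rewrite Tt /d.
  by apply/rowP => k; rewrite !mxE; ring.
move=> /eqP; rewrite eq_sym addrC -subr_eq0 addrK oppr_eq0 => /eqP ed0.
have : dot d (e *: d) = 0 by rewrite ed0 dot0r.
rewrite dotZr /e divfK // => /eqP; rewrite mulf_eq0 pnatr_eq0 /= => /eqP //.
Qed.

(** Pythagoras at the point of tangency; the two tangent lengths add up to the
    edge because that point lies between the endpoints. *)
Lemma tangent_lengthD {K : realType} {n : nat} (c : 'rV[K]_n) (r : K)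
    (U V : 'rV[K]_n) :
  tangent_to_segment c r U V ->
  exists p q : K, [/\ 0 <= p, 0 <= q, p + q = edist U V,
    dot (U - c) (U - c) = r ^+ 2 + p ^+ 2 &
    dot (V - c) (V - c) = r ^+ 2 + q ^+ 2].
Proof.
move=> [T [t /andP[t0 t1] Tt] tgT].
have orth := tangent_orthogonal _ _ _ _ _ tgT.
have [Tr _] : (sphere c r `&` line U V)%classic T by rewrite tgT.
have UV0 : 0 <= edist U V by rewrite edist_dot sqrtr_ge0.
have r2 : r ^+ 2 = dot (T - c) (T - c) by rewrite -Tr edist_sqr.
have UV2 : edist U V ^+ 2 = dot (V - U) (V - U).
  by rewrite edistC edist_sqr.
exists (t * edist U V), ((1 - t) * edist U V); split.
- exact: mulr_ge0.
- by rewrite mulr_ge0 // subr_ge0.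
- by ring.
- have -> : U - c = (T - c) + (- t) *: (V - U).
    by rewrite Tt; apply/rowP => k; rewrite !mxE; ring.
  move: UV2 r2 orth; move: (V - U) (T - c) => d p UV2 r2 orth.
  rewrite exprMn UV2 r2 dotDl !dotDr !dotZl !dotZr (dotC d) orth.
  by ring.
- have -> : V - c = (T - c) + (1 - t) *: (V - U).
    by rewrite Tt; apply/rowP => k; rewrite !mxE; ring.
  move: UV2 r2 orth; move: (V - U) (T - c) => d p UV2 r2 orth.
  rewrite exprMn UV2 r2 dotDl !dotDr !dotZl !dotZr (dotC d) orth.
  by ring.
Qed.

(** Three indices suffice: the difference [f - g] changes sign between any two
    indices, hence is equal to its own opposite. *)
Lemma eq_fun_of_pair_sums {K : numDomainType} {n : nat} (f g : 'I_n.+1 -> K) :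
  (2 <= n)%N -> (forall i j, i != j -> f i + f j = g i + g j) -> f =1 g.
Proof.
move=> n2 fg i.
have : (1 < #|[set~ i]|)%N by rewrite cardsC1 card_ord.
move=> /card_gt1P[j [k [ji ki jk]]].
rewrite !inE in ji ki.
have eij := fg _ _ ji; have eik := fg _ _ ki; have ejk := fg _ _ jk.
have : (f i - g i) *+ 2 = 0.
  have -> : (f i - g i) *+ 2 = (f j + f i) - (g j + g i) + ((f k + f i) - (g k + g i))
     - ((f j + f k) - (g j + g k)) by ring.
  by rewrite eij eik ejk !subrr addr0 subr0.
by move=> /eqP; rewrite mulrn_eq0 /= subr_eq0 => /eqP.
Qed.

Lemma edge_tangent_center {K : realType} {n : nat} (A : 'I_n.+1 -> 'rV[K]_n)
    (x : 'I_n.+1 -> K) (c : 'rV[K]_n) (r : K) :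
  (2 <= n)%N -> is_balloon_radii A x -> is_edge_tangent_sphere A c r ->
  forall i, dot (A i - c) (A i - c) = r ^+ 2 + x i ^+ 2.
Proof.
move=> n2 [x0 xE] [r0 tg].
(* [q i] is the power of [A i]: the square of its tangent length. *)
pose q i := dot (A i - c) (A i - c) - r ^+ 2.
have lt_q (i j : 'I_n.+1) : (i < j)%N ->
    [/\ 0 <= q i, 0 <= q j & Num.sqrt (q i) + Num.sqrt (q j) = x i + x j].
  move=> ij; have [a [b [a0 b0 ab ia jb]]] := tangent_lengthD _ _ _ _ (tg _ _ ij).
  have -> : q i = a ^+ 2 by rewrite /q ia addrC addKr.
  have -> : q j = b ^+ 2 by rewrite /q jb addrC addKr.
  by rewrite !sqrtr_sqr !ger0_norm // !sqr_ge0 -xE.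
have ne_q (i j : 'I_n.+1) : i != j ->
    0 <= q i /\ Num.sqrt (q i) + Num.sqrt (q j) = x i + x j.
  rewrite neq_ltn => /orP[/lt_q[]|/lt_q[? ? E]] //.
  by split=> //; rewrite addrC E addrC.
have sq := eq_fun_of_pair_sums (Num.sqrt \o q) x n2 (fun i j ij => (ne_q i j ij).2).
move=> i; have qi0 : 0 <= q i.
  have : (0 < #|[set~ i]|)%N by rewrite cardsC1 card_ord ltnW.
  move=> /card_gt0P[j]; rewrite !inE eq_sym => /ne_q[] //.
by rewrite -(sq i) /= sqr_sqrtr // [RHS]addrC subrK.
Qed.

(** Polarization: the edge [A_i A_j] has length [x_i + x_j]. *)
Lemma gram_center {K : realType} {n : nat} (A : 'I_n.+1 -> 'rV[K]_n)
    (x : 'I_n.+1 -> K) (c : 'rV[K]_n) (r : K) :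
  is_balloon_radii A x ->
  (forall i, dot (A i - c) (A i - c) = r ^+ 2 + x i ^+ 2) ->
  forall i j, dot (A i - c) (A j - c) =
    r ^+ 2 - x i * x j + (2 * x i ^+ 2) *+ (i == j).
Proof.
move=> [_ xE] cE i j; have [<-|ij] := eqVneq i j; first by rewrite cE mulr1n; ring.
have dE : edist (A i) (A j) = x i + x j.
  move: ij; rewrite neq_ltn => /orP[/xE //|/xE].
  by rewrite edistC [x j + x i]addrC.
have := edist_sqr (A i) (A j).
have -> : A i - A j = (A i - c) - (A j - c) by rewrite opprB subrKA.
rewrite dE; move: (cE i) (cE j); move: (A i - c) (A j - c) => u v ui vj.
rewrite dotDl !dotDr !dotNl !dotNr ui vj (dotC v) mulr0n => E.
by lra.
Qed.

(** * Barycentric coordinates *)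

(** For [n + 1] points of [n]-space, affine independence says that the
    vertices, each extended by a coordinate [1], are the rows of an invertible
    square matrix. *)
Lemma barycentric_exists {K : realType} {n : nat} (A : 'I_n.+1 -> 'rV[K]_n)
    (X : 'rV[K]_n) : is_simplex A ->
  exists2 l : 'I_n.+1 -> K, \sum_i l i = 1 & \sum_i l i *: A i = X.
Proof.
move=> hA.
pose B : 'M[K]_(n.+1, 1 + n) := row_mx (const_mx 1) (\matrix_i A i).
have mulB (u : 'rV[K]_n.+1) :
    u *m B = row_mx (\sum_i u 0 i)%:M (\sum_i u 0 i *: A i).
  rewrite mul_mx_row; congr row_mx.
    apply/rowP => k; rewrite !mxE ord1 eqxx mulr1n.
    by apply: eq_bigr => i _; rewrite mxE mulr1.
  by rewrite mulmx_sum_row; apply: eq_bigr => i _; rewrite rowK.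
have uB : B \in unitmx.
  rewrite -row_free_unit -kermx_eq0; apply/eqP/row_matrixP => k; rewrite row0.
  have : row k (kermx B) *m B = 0 by rewrite -row_mul mulmx_ker row0.
  rewrite mulB -[0 in RHS]row_mx0 => /eq_row_mx[/matrixP/(_ 0 0) s0 v0].
  apply/rowP => i; rewrite [RHS]mxE.
  by apply: (hA (fun i => row k (kermx B) 0 i)) => //; rewrite !mxE mulr1n in s0.
pose u : 'rV[K]_n.+1 := row_mx 1 X *m invmx B.
have : u *m B = row_mx 1 X by rewrite mulmxKV.
rewrite mulB => /eq_row_mx[/matrixP/(_ 0 0) s1 vX].
by exists (fun i => u 0 i) => //; rewrite !mxE mulr1n in s1.
Qed.

Lemma sub_bary {K : realType} {n m : nat} (A : 'I_m -> 'rV[K]_n)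
    (l : 'I_m -> K) (c : 'rV[K]_n) :
  \sum_i l i = 1 -> \sum_i l i *: A i - c = \sum_i l i *: (A i - c).
Proof.
move=> l1; rewrite -[X in _ - X]scale1r -l1 scaler_suml -sumrB.
by apply: eq_bigr => i _; rewrite scalerBr.
Qed.

Lemma dot_center_bary {K : realType} {n : nat} (A : 'I_n.+1 -> 'rV[K]_n)
    (x : 'I_n.+1 -> K) (c : 'rV[K]_n) (r : K) (l : 'I_n.+1 -> K) :
  is_balloon_radii A x ->
  (forall i, dot (A i - c) (A i - c) = r ^+ 2 + x i ^+ 2) ->
  \sum_i l i = 1 ->
  forall i, dot (A i - c) (\sum_j l j *: A j - c) =
    r ^+ 2 - (\sum_j l j * x j) * x i + 2 * x i ^+ 2 * l i.
Proof.
move=> hx cE l1 i; rewrite sub_bary // dot_sumr.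
under eq_bigr => j _ do rewrite dotZr (gram_center _ _ _ _ hx cE).
rewrite -[r ^+ 2 in RHS]mulr1 -[X in r ^+ 2 * X]l1 mulr_sumr mulr_suml -sumrB.
rewrite [2 * _ * _ in RHS](_ : _ = \sum_j l j * ((2 * x i ^+ 2) *+ (i == j))).
  by rewrite -big_split; apply: eq_bigr => j _ /=; ring.
rewrite (bigD1 i) //= eqxx big1 ?addr0; first by rewrite mulr1n mulrC.
by move=> j; rewrite eq_sym => /negbTE ->; rewrite mulr0n mulr0.
Qed.

(** Both centres have barycentric coordinates of the form
    [a + b / x_i + d / x_i^2]; the balloon radii enter the answer only through
    the moments of these. *)
Lemma bary_moments {K : realType} {m : nat} (x l : 'I_m -> K) (a b d : K) :
  (forall i, 0 < x i) ->
  (forall i, x i ^+ 2 * l i = a * x i ^+ 2 + b * x i + d) ->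
  [/\ \sum_i l i = a * m%:R + b * (\sum_i (x i)^-1) + d * \sum_i (x i ^+ 2)^-1,
      \sum_i l i * x i = a * (\sum_i x i) + b * m%:R + d * \sum_i (x i)^-1 &
      \sum_i l i * x i ^+ 2 =
        a * (\sum_i x i ^+ 2) + b * (\sum_i x i) + d * m%:R].
Proof.
move=> x0 xl.
have lE i : l i = a + b * (x i)^-1 + d * (x i ^+ 2)^-1.
  have xi0 : x i != 0 by rewrite gt_eqF.
  apply: (mulfI (expf_neq0 2 xi0)); rewrite xl.
  by field.
have mE : m%:R = \sum_(i < m) (1 : K) by rewrite sumr_const card_ord.
rewrite mE !mulr_sumr -!big_split /=.
by split; apply: eq_bigr => i _; rewrite lE; field; rewrite gt_eqF.
Qed.

(** * The two radii *)

Lemma edge_inradius_sqr {K : realType} {n : nat} (A : 'I_n.+1 -> 'rV[K]_n)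
    (x : 'I_n.+1 -> K) (c : 'rV[K]_n) (r : K) :
  is_simplex A -> is_balloon_radii A x ->
  (forall i, dot (A i - c) (A i - c) = r ^+ 2 + x i ^+ 2) ->
  r ^+ 2 * ((\sum_i (x i)^-1) ^+ 2 - (n%:R - 1) * \sum_i (x i ^+ 2)^-1) =
    2 * (n%:R - 1).
Proof.
move=> hA hx cE; have [l l1 lc] := barycentric_exists _ c hA.
have dE := dot_center_bary _ _ _ _ _ hx cE l1.
set s := \sum_j l j * x j in dE.
have xl i : x i ^+ 2 * l i = 0 * x i ^+ 2 + s / 2 * x i + - (r ^+ 2 / 2).
  by have := dE i; rewrite lc subrr dot0r; lra.
have [] := bary_moments _ _ _ _ _ hx.1 xl; rewrite l1 -/s -(natr1 n).
set P := \sum_i _^-1; set Q := \sum_i (_ ^+ 2)^-1 => e1 e2 _.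
have e1' : r ^+ 2 * Q = s * P - 2 by lra.
have e2' : s * (n%:R - 1) = r ^+ 2 * P by lra.
have -> : r ^+ 2 * (P ^+ 2 - (n%:R - 1) * Q) =
    (r ^+ 2 * P) * P - (n%:R - 1) * (r ^+ 2 * Q) by ring.
by rewrite -e2' e1'; ring.
Qed.

Lemma circumradius_sqr {K : realType} {n : nat} (A : 'I_n.+1 -> 'rV[K]_n)
    (x : 'I_n.+1 -> K) (c : 'rV[K]_n) (r R : K) :
  let M := \sum_i x i in let N := \sum_i x i ^+ 2 in
  let P := \sum_i (x i)^-1 in let Q := \sum_i (x i ^+ 2)^-1 in
  is_simplex A -> is_balloon_radii A x ->
  (forall i, dot (A i - c) (A i - c) = r ^+ 2 + x i ^+ 2) ->
  is_circumradius A R ->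
  8 * (n%:R - 1) * (P ^+ 2 - (n%:R - 1) * Q) * R ^+ 2 =
  (M * P - (n%:R - 1) * (n%:R - 3)) ^+ 2
    - (M ^+ 2 - (n%:R - 1) * N) * (P ^+ 2 - (n%:R - 1) * Q).
Proof.
move=> M N P Q hA hx cE [O OR]; have [l l1 lO] := barycentric_exists _ O hA.
have dE := dot_center_bary _ _ _ _ _ hx cE l1.
set s := \sum_j l j * x j in dE; rewrite lO in dE.
set w := O - c in dE.
(* The power of [c] with respect to the circumsphere, shifted by [r ^+ 2]. *)
pose k := dot w w - R ^+ 2 - r ^+ 2.
have wE i : 2 * dot (A i - c) w = x i ^+ 2 + k + 2 * r ^+ 2.
  have : R ^+ 2 = dot (A i - O) (A i - O) by rewrite -(OR i) edist_sqr.
  have -> : A i - O = (A i - c) - w by rewrite opprB subrKA.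
  move: (cE i) w @k {dE}; move: (A i - c) => v vE w k.
  by rewrite dotDl !dotDr !dotNl !dotNr vE (dotC w) /k; lra.
have xl i : x i ^+ 2 * l i = 4^-1 * x i ^+ 2 + s / 2 * x i + k / 4.
  by have := wE i; rewrite dE; lra.
have [] := bary_moments _ _ _ _ _ hx.1 xl; rewrite l1 -/s -(natr1 n) -/M -/N -/P -/Q.
move=> e1 e2 e3.
have ww : 2 * dot w w = \sum_i l i * x i ^+ 2 + k + 2 * r ^+ 2.
  rewrite {2}/w -lO sub_bary // dot_sumr mulr_sumr.
  rewrite -[k in RHS]mulr1 -[2 * r ^+ 2 in RHS]mulr1.
  rewrite -[X in k * X]l1 -[X in 2 * r ^+ 2 * X]l1 !mulr_sumr -!big_split /=.
  apply: eq_bigr => i _; rewrite dotZr dotC mulrCA wE; ring.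
have RE : 8 * R ^+ 2 = N + 2 * s * M + k * (n%:R - 3).
  by move: ww; rewrite e3 /k; lra.
(* Eliminating [s] between the two linear equations for [s] and [k]. *)
have sE : 2 * (n%:R - 1) * s = - (M + k * P) by lra.
have kE : k * (P ^+ 2 - (n%:R - 1) * Q) = - (M * P - (n%:R - 1) * (n%:R - 3)).
  have e1' : k * Q = (3 - n%:R) - 2 * s * P by lra.
  transitivity (k * P * P - (n%:R - 1) * (k * Q)); first by ring.
  rewrite e1'; transitivity ((k * P + 2 * (n%:R - 1) * s) * P - (n%:R - 1) * (3 - n%:R)).
    by ring.
  by rewrite sE; ring.
set D := P ^+ 2 - _ * Q in kE *; set E := M * P - _ in kE *.
transitivity ((n%:R - 1) * D * (8 * R ^+ 2)); first by ring.
rewrite RE.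
transitivity ((n%:R - 1) * D * N + D * M * (2 * (n%:R - 1) * s)
   + (n%:R - 1) * (n%:R - 3) * (k * D)); first by ring.
rewrite sE kE.
transitivity ((n%:R - 1) * D * N - D * M ^+ 2 - (M * P) * (k * D)
   - (n%:R - 1) * (n%:R - 3) * E); first by ring.
by rewrite kE /E; ring.
Qed.

Theorem theorem2p1 (K : realType) (n : nat) (A : 'I_n.+1 -> 'rV[K]_n)
    (x : 'I_n.+1 -> K) (R rho : K)
    (hn : (2 <= n)%N)
    (hA : is_simplex A)
    (hcirc : circumscriptible A)
    (hx : is_balloon_radii A x)
    (hR : is_circumradius A R)
    (hrho : is_edge_inradius A rho) :
  let M := \sum_(i < n.+1) x i in
  let N := \sum_(i < n.+1) x i ^+ 2 in
  let P := \sum_(i < n.+1) (x i)^-1 in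
  let Q := \sum_(i < n.+1) (x i ^+ 2)^-1 in
  (R / rho) ^+ 2 =
    ((M * P - (n%:R - 1) * (n%:R - 3)) ^+ 2
      - (M ^+ 2 - (n%:R - 1) * N) * (P ^+ 2 - (n%:R - 1) * Q))
    / (16 * (n%:R - 1) ^+ 2)
  /\
  R ^+ 2 =
    ((M * P - (n%:R - 1) * (n%:R - 3)) ^+ 2
      - (M ^+ 2 - (n%:R - 1) * N) * (P ^+ 2 - (n%:R - 1) * Q))
    / (8 * (n%:R - 1) * (P ^+ 2 - (n%:R - 1) * Q)).
Proof.
move=> M N P Q; have [c tg] := hrho.
have cE := edge_tangent_center _ _ _ _ hn hx tg.
have rE := edge_inradius_sqr _ _ _ _ hA hx cE.
have <- := circumradius_sqr _ _ _ _ _ hA hx cE hR; rewrite -/P -/Q in rE *.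
have n1 : n%:R - 1 != 0 :> K by rewrite subr_eq0 pnatr_eq1 gtn_eqF.
set D := P ^+ 2 - _ in rE *.
have DN0 : D != 0.
  apply: contraNneq n1 => D0; move: rE; rewrite D0 mulr0 => /esym/eqP.
  by rewrite mulf_eq0 pnatr_eq0.
have r0 : rho != 0 by rewrite gt_eqF ?tg.1.
split; last by field; rewrite n1 DN0.
have -> : 8 * (n%:R - 1) * D * R ^+ 2 =
    (2 * (n%:R - 1)) * (4 * D * R ^+ 2) by ring.
have -> : 16 * (n%:R - 1) ^+ 2 = 4 * (2 * (n%:R - 1)) * (2 * (n%:R - 1)) :> K by ring.
rewrite -rE.
by field; rewrite r0 DN0.
Qed.
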